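(* Let $k$ be an algebraically closed field, $Q$ a finite quiver, $I\subset kQ$ an admissible ideal, $B=kQ/I$ and $n=\dim_kB$. Then $\operatorname{AlgGr}_{n-1}(B)$ is irreducible if and only if the Ext-quiver $Q$ of $B$ is an $m$-loop quiver for some $m\ge1$, an $m$-Kronecker quiver for some $m\ge1$, or the quiver consisting of two isolated vertices.
   Context: Algebras are unital, associative, finite-dimensional over $k$; subalgebras contain the unit. $\operatorname{AlgGr}_m(B)$ is the set of $m$-dimensional subalgebras of $B$, a closed subvariety of the Grassmannian $\operatorname{Gr}_m(B)$ of $m$-dimensional subspaces of $B$ (the empty variety is not considered irreducible). $kQ$ is the path algebra, $J(Q)$ its two-sided ideal generated by the arrows, and $I$ is admissible if $J(Q)^2\supset I\supset J(Q)^\ell$ for some $\ell\ge2$. The $m$-loop quiver has one vertex and $m$ loops at it. The $m$-Kronecker quiver has two vertices $s\neq t$ and exactly $m$ arrows, all from $s$ to $t$. The two isolated vertices quiver has two vertices and no arrows. *)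

(* Defs.v *)
From HB Require Import structures.
From mathcomp Require Import all_boot all_order all_algebra all_field.
From mathcomp Require Import freeg mpoly.

Set Implicit Arguments.
Unset Strict Implicit.
Unset Printing Implicit Defensive.

Import GRing.Theory.
Local Open Scope ring_scope.

Record quiver := Quiver {
  vertex : finType;
  arrow : finType;
  source : arrow -> vertex;
  target : arrow -> vertex
}.

Section Paths.

Variable Q : quiver.
Implicit Types (x y z : vertex Q) (s t : seq (arrow Q)).

Fixpoint walk x s y : bool :=
  if s is a :: s' then (source a == x) && walk (target a) s' y else x == y.

(* A path is stored as (start, arrows in the order they are traversed, end);
   the endpoints are kept so that each vertex has its own trivial path. *)
Definition qpath :=
  {p : vertex Q * seq (arrow Q) * vertex Q | walk p.1.1 p.1.2 p.2}.

HB.instance Definition _ := Choice.on qpath.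

Definition pstart (p : qpath) : vertex Q := (val p).1.1.
Definition parrows (p : qpath) : seq (arrow Q) := (val p).1.2.
Definition pend (p : qpath) : vertex Q := (val p).2.

Definition trivial_path x : qpath := exist _ (x, [::], x) (eqxx x).

Lemma walk_arrow (a : arrow Q) : walk (source a) [:: a] (target a).
Proof. by rewrite /= !eqxx. Qed.

Definition arrow_path (a : arrow Q) : qpath :=
  exist _ (source a, [:: a], target a) (walk_arrow a).

Lemma walk_cat x s y t z : walk x s y -> walk y t z -> walk x (s ++ t) z.
Proof.
elim: s x => [|a s IHs] x /=; first by move/eqP->.
by case/andP=> -> /IHs h /h.
Qed.

Lemma qpathP (p : qpath) : walk (pstart p) (parrows p) (pend p).
Proof. exact: (valP p). Qed.

(* First p, then q. *)
Definition pconcat (p q : qpath) (h : pend p = pstart q) : qpath :=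
  exist _ (pstart p, parrows p ++ parrows q, pend q)
    (walk_cat (qpathP p) (eq_ind_r (fun v => walk v _ _) (qpathP q) h)).

Definition pcomp (p q : qpath) : option qpath :=
  if pend p =P pstart q is ReflectT h then Some (pconcat h) else None.

Lemma qpath_inj (p q : qpath) :
  pstart p = pstart q -> parrows p = parrows q -> pend p = pend q -> p = q.
Proof.
move=> h1 h2 h3; apply: val_inj; move: h1 h2 h3; rewrite /pstart /parrows /pend.
by case: (val p) => [[? ?] ?]; case: (val q) => [[? ?] ?] /= -> -> ->.
Qed.

Lemma pcompE (p q r : qpath) : pend p = pstart q -> pstart r = pstart p ->
  parrows r = parrows p ++ parrows q -> pend r = pend q -> pcomp p q = Some r.
Proof.
move=> h h1 h2 h3; rewrite /pcomp; case: eqP => // h'.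
by congr Some; apply: qpath_inj.
Qed.

Lemma pcomp_None (p q : qpath) : pend p <> pstart q -> pcomp p q = None.
Proof. by move=> h; rewrite /pcomp; case: eqP. Qed.

End Paths.

Section LiftTheory.

Variables (R : comNzRingType) (K : choiceType) (M : lmodType R).
Implicit Types (f g : K -> M) (a b : {freeg K / R}).

Lemma fgliftE f a : fglift f a = \sum_(x <- dom a) coeff x a *: f x.
Proof. by rewrite -{1}[a]Freeg_dom fglift_Freeg /prelift big_map. Qed.

Lemma fgliftD f a b : fglift f (a + b) = fglift f a + fglift f b.
Proof.
have h := lift_is_additive f.
have h0 : fglift f 0 = 0 by rewrite -{1}(subrr 0) h subrr.
have hN c : fglift f (- c) = - fglift f c by rewrite -sub0r h h0 sub0r.
by rewrite -{1}[b]opprK h hN opprK.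
Qed.

Lemma fglift0 f : fglift f 0 = 0.
Proof. by rewrite fgliftE dom0 big_nil. Qed.

Lemma fgliftZ f c a : fglift f (c *: a) = c *: fglift f a.
Proof.
rewrite [c *: a]/GRing.scale /= /fgscale.
rewrite (big_morph (fglift f) (fgliftD f) (fglift0 f)) [in RHS]fgliftE.
by rewrite scaler_sumr; apply: eq_bigr => x _; rewrite liftU scalerA.
Qed.

Lemma eq_fglift f g : f =1 g -> fglift f =1 fglift g.
Proof. by move=> h a; rewrite !fgliftE; apply: eq_bigr => x _; rewrite h. Qed.

Lemma fgliftDf f g a : fglift (fun x => f x + g x) a = fglift f a + fglift g a.
Proof.
by rewrite !fgliftE -big_split; apply: eq_bigr => x _; rewrite scalerDr.
Qed.

Lemma fgliftZf c f a : fglift (fun x => c *: f x) a = c *: fglift f a.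
Proof.
rewrite !fgliftE scaler_sumr; apply: eq_bigr => x _.
by rewrite !scalerA mulrC.
Qed.

End LiftTheory.

Lemma fglift_comp (R : comNzRingType) (K : choiceType) (M N : lmodType R)
    (h : M -> N) (f : K -> M) (a : {freeg K / R}) :
  (forall u v, h (u + v) = h u + h v) -> (forall c u, h (c *: u) = c *: h u) ->
  h (fglift f a) = fglift (h \o f) a.
Proof.
move=> hD hZ; rewrite !fgliftE.
have h0 : h 0 = 0 by rewrite -[0 in LHS](scale0r (0 : M)) hZ scale0r.
by rewrite (big_morph h hD h0); apply: eq_bigr => x _; rewrite hZ.
Qed.

Lemma fglift_id (R : comNzRingType) (K : choiceType) (a : {freeg K / R}) :
  fglift (fun x => << x >>) a = a.
Proof.
rewrite fgliftE -[RHS]freeg_sumE; apply: eq_bigr => x _.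
apply/eqP/freeg_eqP => y; rewrite coeffZ !coeffU.
by rewrite mul1r.
Qed.

Definition pathalg (k : fieldType) (Q : quiver) := {freeg (qpath Q) / k}.

Section PathAlgebra.

Variables (k : fieldType) (Q : quiver).
Local Notation kQ := (pathalg k Q).
Implicit Types (p q r : qpath Q) (a b c : kQ).

HB.instance Definition _ := GRing.Lmodule.on kQ.

Definition path_elt (p : qpath Q) : kQ := << p >>.

Definition path_mul (p q : qpath Q) : kQ :=
  if pcomp p q is Some r then path_elt r else 0.

Definition pathalg_mul (a b : kQ) : kQ :=
  fglift (fun p => fglift (path_mul p) b) a.

Definition pathalg_one : kQ := \sum_(x : vertex Q) path_elt (trivial_path x).

Lemma fglift_elt (M : lmodType k) (f : qpath Q -> M) p :
  fglift f (path_elt p) = f p.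
Proof. by rewrite liftU scale1r. Qed.

Lemma pathalg_mulDl : left_distributive pathalg_mul +%R.
Proof. by move=> a b c; rewrite /pathalg_mul fgliftD. Qed.

Lemma pathalg_mulDr : right_distributive pathalg_mul +%R.
Proof.
move=> a b c; rewrite /pathalg_mul -fgliftDf.
by apply: eq_fglift => p; rewrite fgliftD.
Qed.

Lemma pathalg_mulZl z a b : pathalg_mul (z *: a) b = z *: pathalg_mul a b.
Proof. exact: fgliftZ. Qed.

Lemma pathalg_mulZr z a b : pathalg_mul a (z *: b) = z *: pathalg_mul a b.
Proof.
rewrite /pathalg_mul -fgliftZf.
by apply: eq_fglift => p; rewrite fgliftZ.
Qed.

Lemma pathalg_mul0r a : pathalg_mul 0 a = 0.
Proof. exact: fglift0. Qed.

Lemma pathalg_mulr0 a : pathalg_mul a 0 = 0.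
Proof. by have := pathalg_mulZr 0 a 0; rewrite !scale0r. Qed.

Lemma pathalg_mul_elt p q :
  pathalg_mul (path_elt p) (path_elt q) = path_mul p q.
Proof. by rewrite /pathalg_mul !fglift_elt. Qed.

Lemma path_mulA p q r :
  pathalg_mul (path_elt p) (path_mul q r) =
  pathalg_mul (path_mul p q) (path_elt r).
Proof.
rewrite /path_mul /pcomp; case: eqP => [h1|n1]; case: eqP => [h2|n2].
- rewrite !pathalg_mul_elt /path_mul.
  rewrite (pcompE (p := p) (r := pconcat (p := pconcat h2) h1)) //=.
    by rewrite (pcompE (p := pconcat h2) (r := pconcat (p := pconcat h2) h1)).
  by rewrite /parrows /= catA.
- by rewrite pathalg_mul0r pathalg_mul_elt /path_mul pcomp_None.
- by rewrite pathalg_mulr0 pathalg_mul_elt /path_mul pcomp_None.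
- by rewrite pathalg_mulr0 pathalg_mul0r.
Qed.

Lemma pathalg_ind (P : kQ -> Prop) :
  P 0 -> (forall a b, P a -> P b -> P (a + b)) ->
  (forall z a, P a -> P (z *: a)) -> (forall p, P (path_elt p)) ->
  forall a, P a.
Proof.
move=> P0 PD PZ Pe a; rewrite -[a]fglift_id fgliftE.
by elim/big_ind: _ => // p _; apply: PZ; apply: Pe.
Qed.

Lemma pathalg_mulA : associative pathalg_mul.
Proof.
move=> a b c; elim/pathalg_ind: a => [|a a' IH IH'|z a IH|p].
- by rewrite !pathalg_mul0r.
- by rewrite !pathalg_mulDl IH IH'.
- by rewrite !pathalg_mulZl IH.
elim/pathalg_ind: b => [|b b' IH IH'|z b IH|q].
- by rewrite !(pathalg_mul0r, pathalg_mulr0).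
- by rewrite !(pathalg_mulDl, pathalg_mulDr) IH IH'.
- by rewrite !(pathalg_mulZl, pathalg_mulZr) IH.
elim/pathalg_ind: c => [|c c' IH IH'|z c IH|r].
- by rewrite !pathalg_mulr0.
- by rewrite !pathalg_mulDr IH IH'.
- by rewrite !pathalg_mulZr IH.
by rewrite !pathalg_mul_elt path_mulA.
Qed.

Lemma pathalg_mul1 : left_id pathalg_one pathalg_mul.
Proof.
elim/pathalg_ind => [|b b' IH IH'|z b IH|q].
- by rewrite pathalg_mulr0.
- by rewrite pathalg_mulDr IH IH'.
- by rewrite pathalg_mulZr IH.
rewrite /pathalg_one (big_morph (pathalg_mul^~ (path_elt q))
  (fun x y => pathalg_mulDl x y _) (pathalg_mul0r _)).
rewrite (bigD1 (pstart q)) //= pathalg_mul_elt /path_mul (pcompE (r := q)) //.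
rewrite big1 ?addr0 // => x /eqP h.
by rewrite pathalg_mul_elt /path_mul pcomp_None.
Qed.

Lemma pathalg_mulr1 : right_id pathalg_one pathalg_mul.
Proof.
elim/pathalg_ind => [|b b' IH IH'|z b IH|q].
- by rewrite pathalg_mul0r.
- by rewrite pathalg_mulDl IH IH'.
- by rewrite pathalg_mulZl IH.
rewrite /pathalg_one (big_morph (pathalg_mul (path_elt q))
  (fun x y => pathalg_mulDr _ x y) (pathalg_mulr0 _)).
rewrite (bigD1 (pend q)) //= pathalg_mul_elt /path_mul.
rewrite (pcompE (r := q)) //= ?cats0 //.
rewrite big1 ?addr0 // => x /eqP h.
by rewrite pathalg_mul_elt /path_mul pcomp_None //; apply/nesym.
Qed.

(* Only a [pzRingType]: without vertices the path algebra is zero. *)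
HB.instance Definition _ := GRing.Zmodule_isPzRing.Build kQ
  pathalg_mulA pathalg_mul1 pathalg_mulr1 pathalg_mulDl pathalg_mulDr.

Definition two_sided_ideal (I : kQ -> Prop) : Prop :=
  [/\ I 0, forall a b, I a -> I b -> I (a + b),
      forall a b, I b -> I (a * b) & forall a b, I a -> I (a * b)].

Definition arrow_ideal (x : kQ) : Prop :=
  forall I : kQ -> Prop, two_sided_ideal I ->
    (forall a : arrow Q, I (path_elt (arrow_path a))) -> I x.

Definition ideal_mul (I1 I2 : kQ -> Prop) (x : kQ) : Prop :=
  exists2 s : seq (kQ * kQ),
    (forall u, u \in s -> I1 u.1 /\ I2 u.2) & x = \sum_(u <- s) u.1 * u.2.

Fixpoint ideal_exp (I : kQ -> Prop) (l : nat) : kQ -> Prop :=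
  if l is l'.+1 then ideal_mul I (ideal_exp I l') else fun _ => True.

Definition admissible (I : kQ -> Prop) : Prop :=
  [/\ two_sided_ideal I,
      forall x, I x -> ideal_exp arrow_ideal 2 x
    & exists2 l : nat, (2 <= l)%N & forall x, ideal_exp arrow_ideal l x -> I x].

End PathAlgebra.

Definition is_loop_quiver (m : nat) (Q : quiver) : Prop :=
  #|vertex Q| = 1%N /\ #|arrow Q| = m.

Definition is_kronecker_quiver (m : nat) (Q : quiver) : Prop :=
  exists s t : vertex Q,
    [/\ s != t, forall x, (x == s) || (x == t),
        forall a : arrow Q, source a = s /\ target a = t & #|arrow Q| = m].

Definition is_two_isolated_vertices (Q : quiver) : Prop :=
  #|vertex Q| = 2%N /\ #|arrow Q| = 0%N.

Section Grassmannian.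

Variables (k : fieldType) (V : vectType k) (m : nat).

Definition Gr (U : {vspace V}) : Prop := \dim U = m.

Definition plucker_index :=
  {t : m.-tuple 'I_(\dim {:V}) | sorted ltn [seq val i | i <- t]}.

HB.instance Definition _ := Finite.on plucker_index.

(* The m x m minors of the basis [vbasis U] of U, in the coordinates given by
   [vbasis {:V}]; meaningful when [\dim U = m]. Another basis of U rescales all
   of them by a common nonzero factor, which homogeneous equations do not see,
   and another basis of V changes them by a fixed linear automorphism. *)
Definition plucker (U : {vspace V}) (i : 'I_#|{: plucker_index}|) : k :=
  \det (\matrix_(r < m, c < m)
          coord (vbasis {:V}) (tnth (val (enum_val i)) c) (vbasis U)`_r).

(* Zariski closed subsets of Gr_m(V), in its Plücker embedding. *)
Definition zariski_closed (Z : {vspace V} -> Prop) : Prop :=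
  exists2 F : {mpoly k[#|{: plucker_index}|]} -> Prop,
    forall f, F f -> exists d : nat, f \is d.-homog
  & forall U, Z U <-> Gr U /\ forall f, F f -> f.@[plucker U] = 0.

Definition zariski_irreducible (A : {vspace V} -> Prop) : Prop :=
  (exists U, A U) /\
  forall Z1 Z2 : {vspace V} -> Prop,
    zariski_closed Z1 -> zariski_closed Z2 ->
    (forall U, A U -> Z1 U \/ Z2 U) ->
    (forall U, A U -> Z1 U) \/ (forall U, A U -> Z2 U).

End Grassmannian.

(* [{aspace B}] is not used: its members may have a unit other than 1. *)
Definition AlgGr (k : fieldType) (B : falgType k) (m : nat)
    (U : {vspace B}) : Prop :=
  [/\ Gr m U, 1 \in U & (U * U <= U)%VS].

Arguments AlgGr {k} B m U.

(* Main.v *)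
Require Import Defs.
From HB Require Import structures.
From mathcomp Require Import all_boot all_order all_algebra all_field.
From mathcomp Require Import freeg mpoly.
From Stdlib Require Import Classical.
From mathcomp Require Import ring zify.

Set Implicit Arguments.
Unset Strict Implicit.
Unset Printing Implicit Defensive.

Import GRing.Theory.
Local Open Scope ring_scope.

(* A hyperplane U = ker f of B is a subalgebra exactly when, for some vertices
   x and y with characters chi_x, chi_y of B, f is a (chi_x, chi_y)-derivation:
   f(ab) = chi_x(a) f(b) + f(a) chi_y(b). Indeed B/U is one-dimensional, so U
   acts on it on either side through a character, and a character of a
   subalgebra is the restriction of some chi_x because the common kernel of the
   chi_x is nil.
   The Pluecker coordinates of U are, up to signs and a common factor, those of
   f. Hence AlgGr_{n-1}(B) is a finite union of linear subspaces P(Der(x,y)) of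
   projective space, and it is irreducible iff one of the spaces Der(x,y) is
   nonzero and contains all the others. Evaluating chi_x - chi_y, which lies in
   Der(x,y), and the coefficient of an arrow s -> t, which lies in Der(s,t), at
   the vertices and arrows of Q shows for which Q this happens. *)

(** * Hyperplanes in Pluecker coordinates *)

Section HyperplanePlucker.

Variables (k : fieldType) (V : vectType k).
Implicit Types (f g : {scalar V}) (U : {vspace V}).
Local Notation N := (\dim {:V}).

Definition kernel_of f U := forall v, (v \in U) = (f v == 0).

(** Viewing [f] as a linear map into the one-dimensional space [k^o] makes rank-nullity
    available. *)
Lemma kernel_of_scalar f v0 : f v0 != 0 ->
  exists2 U, kernel_of f U & \dim U = N.-1.
Proof.
move=> f0; pose g (v : V) : k^o := f v.
have lin_g : linear g by move=> c u v; rewrite /g linearP.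
pose h := linfun (HB.pack g (GRing.isLinear.Build k V k^o _ g lin_g)
  : {linear V -> k^o}).
have hE v : h v = f v by rewrite lfunE.
exists (lker h) => [v|]; first by rewrite memv_ker hE.
have := limg_ker_dim h fullv; rewrite capfv.
suff -> : \dim (h @: fullv) = 1%N by rewrite addn1 => <-.
apply/eqP; rewrite eqn_leq; apply/andP; split.
  by rewrite (leq_trans (dimvS (subvf _))) // dimvf.
rewrite lt0n dimv_eq0; apply: contraNneq f0 => h0.
by have := memv_img h (memvf v0); rewrite h0 memv0 hE.
Qed.

Lemma kernel_scalar_proportional f g v0 : f v0 != 0 ->
  (forall v, f v = 0 -> g v = 0) -> forall v, g v = g v0 / f v0 * f v.
Proof.
move=> f0 fg v; have : f (v - (f v / f v0) *: v0) = 0.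
  by rewrite linearB linearZ /= divfK ?subrr.
by move/fg/eqP; rewrite linearB linearZ /= subr_eq0 => /eqP ->; ring.
Qed.

Lemma sorted_lift n (j : 'I_n) :
  sorted ltn [seq val i | i <- map_tuple (fintype.lift j) (ord_tuple n.-1)].
Proof.
rewrite -map_comp.
have -> : [seq (val \o fintype.lift j) i | i <- enum 'I_n.-1]
          = [seq bump j i | i <- [seq val i | i <- enum 'I_n.-1]].
  by rewrite -map_comp.
rewrite val_enum_ord sorted_map; apply: sub_sorted (iota_ltn_sorted 0 _).
by move=> a b /=; rewrite /bump => ab; do 2!case: leqP => //=; lia.
Qed.

(** A Pluecker index of a hyperplane amounts to the one coordinate [j] that it omits. Since [t] has
    no repetition and is too short to cover ['I_n], some [j] is missing; two increasing sequences
    with the same entries are equal. *)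
Lemma sorted_missing n (t : n.-1.-tuple 'I_n) : (0 < n)%N ->
  sorted ltn [seq val i | i <- t] ->
  exists j, forall r, tnth t r = fintype.lift j r.
Proof.
case: n t => [//|n] t _ /= st.
have ut : uniq t.
  by rewrite -(map_inj_uniq val_inj) (sorted_uniq ltn_trans ltnn).
have [j jt] : exists j, j \notin t.
  apply/existsP; rewrite -negb_forall; apply/negP => /forallP h.
  have : (size (enum 'I_n.+1) <= size t)%N.
    by apply: uniq_leq_size; [exact: enum_uniq | move=> x _; apply: h].
  by rewrite size_enum_ord size_tuple ltnn.
exists j => r; pose s := map_tuple (fintype.lift j) (ord_tuple n).
have st' := sorted_lift j.
have sub_ts : {subset t <= s}.
  move=> x xt; apply/mapP; case: (unliftP j x) => [i ->|xj].
    by exists i; rewrite ?mem_enum.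
  by rewrite -xj xt in jt.
have mem_ts : t =i s.
  have [|_ ts x] := uniq_min_size ut sub_ts; last by rewrite ts.
  by rewrite (size_tuple s) (size_tuple t).
have -> : t = s.
  apply: val_inj; apply: (inj_map val_inj).
  apply: (irr_sorted_eq ltn_trans ltnn st st') => x.
  by apply/mapP/mapP => -[y yt ->]; exists y; rewrite // ?mem_ts // -mem_ts.
by rewrite tnth_map tnth_ord_tuple.
Qed.

(** The functional is the determinant with first row [v] and the basis of [U] below it. It kills [U]
    because a row is repeated, it is nonzero at [v0] because [v0] extends the basis freely, and its
    cofactors along the first row are the signed minors. *)
Lemma hyperplane_minors n (X : n.-tuple V) U v0 :
    (0 < n)%N -> basis_of fullv X -> \dim U = n.-1 -> v0 \notin U ->
  exists g : {scalar V}, [/\ g v0 != 0, forall v, v \in U -> g v = 0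
  & forall (t : n.-1.-tuple 'I_n) j, (forall r, tnth t r = fintype.lift j r) ->
    \det (\matrix_(r < n.-1, c < n.-1) coord X (tnth t c) (vbasis U)`_r)
      = (-1) ^+ j * g X`_j].
Proof.
case: n X => [//|n] X _ bX /= dimU v0U.
have [Y YE bY] : exists2 Y : n.-tuple V, tval Y = vbasis U & basis_of U Y.
  by exists (tcast dimU (vbasis U)); rewrite ?val_tcast ?vbasisP.
rewrite -YE; pose M := \matrix_(r < n, c < n.+1) coord X c Y`_r.
pose G v := \matrix_(r < n.+1, c < n.+1)
  (if unlift ord0 r is Some i then M i c else coord X c v).
(* Laplace expansion of [\det (G v)] along its first row. *)
pose g v := \sum_j coord X j v * ((-1) ^+ j * \det (col' j M)).
have lin_g : scalar g.
  move=> c u v; rewrite /g mulr_sumr -big_split; apply: eq_bigr => j _.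
  by rewrite linearP mulrDl mulrA.
have gE v : g v = \det (G v).
  rewrite (expand_det_row _ ord0); apply: eq_bigr => j _.
  rewrite mxE unlift_none /cofactor; congr (_ * (_ * \det _)).
  by apply/matrixP => r c; rewrite !mxE liftK mxE.
pose gs := HB.pack g (GRing.isLinear.Build k V k *%R g lin_g) : {scalar V}.
exists gs; split.
(* A vector [w] in the left kernel is a linear relation between [v0] and the basis of [U]. Either
   the coefficient of [v0] is nonzero and [v0] lies in [U], or the relation contradicts freeness of
   the basis. *)
- rewrite -[gs v0]/(g v0) gE; apply: contra v0U => /det0P[w w0 wG].
  have {}wG : w 0 ord0 *: v0 + \sum_i w 0 (fintype.lift ord0 i) *: Y`_i = 0.
    rewrite (coord_basis bX (memvf (_ + _))) big1 // => j _.
    suff -> : coord X j (w 0 ord0 *: v0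
        + \sum_i w 0 (fintype.lift ord0 i) *: Y`_i) = 0.
      by rewrite scale0r.
    have := congr1 (fun A : 'rV_n.+1 => A 0 j) wG.
    rewrite !mxE big_ord_recl !mxE unlift_none => <-.
    rewrite linearD linearZ /= linear_sum; congr (_ + _).
    by apply: eq_bigr => i _; rewrite linearZ /= mxE liftK mxE.
  have inU : \sum_i w 0 (fintype.lift ord0 i) *: Y`_i \in U.
    apply: memv_suml => i _; apply/memvZ/(basis_mem bY)/mem_nth.
    by rewrite size_tuple.
  have [w00|w00] := eqVneq (w 0 ord0) 0; last first.
    have -> : v0 = - (w 0 ord0)^-1 *: \sum_i w 0 (fintype.lift ord0 i) *: Y`_i.
      move/eqP: wG; rewrite addr_eq0 => /eqP /(congr1 ( *:%R (w 0 ord0)^-1)).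
      by rewrite scalerA mulVf // scale1r => ->; rewrite scalerN scaleNr.
    by rewrite memvZ.
  case/eqP: w0; apply/rowP => j; rewrite mxE.
  case: (unliftP ord0 j) => [i ->|-> //].
  move: wG; rewrite w00 scale0r add0r => wG.
  by have /freeP/(_ (fun i => w 0 (fintype.lift ord0 i)) wG i) := basis_free bY.
- move=> v vU; rewrite (coord_basis bY vU) linear_sum big1 // => i _.
  rewrite linearZ /= gE.
  rewrite (determinant_alternate (i1 := ord0) (i2 := fintype.lift ord0 i)) //.
    by rewrite mulr0.
  by move=> c; rewrite !mxE unlift_none liftK mxE.
move=> t j tj; rewrite -[gs _]/(g _) /g (bigD1 j) //= big1 => [|l lj].
  rewrite (coord_free _ _ (basis_free bX)) eqxx mul1r addr0 mulrA.
  rewrite -expr2 sqrr_sign mul1r.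
  by congr (\det _); apply/matrixP => r c; rewrite !mxE tj.
by rewrite (coord_free _ _ (basis_free bX)) eq_sym (negPf lj) mul0r.
Qed.

Lemma kernel_of_hyperplane f U v0 : f v0 != 0 ->
  (forall v, v \in U -> f v = 0) -> \dim U = N.-1 -> kernel_of f U.
Proof.
move=> f0 fU dimU; have [W fW dimW] := kernel_of_scalar f0.
suff -> : U = W by [].
apply/eqP; rewrite eqEdim dimU dimW leqnn andbT.
by apply/subvP => v /fU fv; rewrite fW fv.
Qed.

Lemma hyperplane_proper U : (0 < N)%N -> \dim U = N.-1 -> exists v, v \notin U.
Proof.
move=> N0 dimU; have : ~~ (fullv <= U)%VS.
  by apply/negP => /dimvS; rewrite dimU leqNgt prednK ?leqnn.
by case/subvPn => v _; exists v.
Qed.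

Lemma hyperplane_kernel U : (0 < N)%N -> \dim U = N.-1 ->
  exists2 f : {scalar V}, (exists v, f v != 0) & kernel_of f U.
Proof.
move=> N0 dimU; have [v0 v0U] := hyperplane_proper N0 dimU.
have [f [f0 fU _]] := hyperplane_minors N0 (vbasisP _) dimU v0U.
by exists f; [exists v0 | exact: kernel_of_hyperplane f0 fU dimU].
Qed.

(** Here [j i] is the coordinate omitted by the index [i], and [s i] is the cofactor sign. The
    factor [c] compares [f] with the determinant functional of [U], which has the same kernel. *)
Lemma plucker_hyperplane : (0 < N)%N ->
  exists (s : 'I_#|{: plucker_index V N.-1}| -> k)
         (j : 'I_#|{: plucker_index V N.-1}| -> 'I_N),
  [/\ forall i, s i * s i = 1, forall l, exists i, j i = l &
      forall U f v0, \dim U = N.-1 -> f v0 != 0 -> kernel_of f U ->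
      exists2 c, c != 0 &
        forall i, plucker U i = c * (s i * f (vbasis {:V})`_(j i))].
Proof.
move=> N0.
have /fin_all_exists[j jP] (i : 'I_#|{: plucker_index V N.-1}|) :
    exists j, forall r, tnth (val (enum_val i)) r = fintype.lift j r.
  exact: sorted_missing N0 (valP (enum_val i)).
exists (fun i => (-1) ^+ j i), j; split=> [i|l|U f v0 dimU f0 fU].
- by rewrite -expr2 sqrr_sign.
- pose t : plucker_index V N.-1 :=
    exist _ (map_tuple (fintype.lift l) (ord_tuple N.-1)) (sorted_lift l).
  (* If the omitted coordinate were not [l], then [l] would occur in a tuple built to skip it. *)
  exists (enum_rank t); apply/eqP/negPn/negP => /unlift_some[r lr _].
  have /negP[] := neq_lift l r.
  rewrite {1}lr -jP enum_rankK /= tnth_map tnth_ord_tuple; exact/eqP.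
have v0U : v0 \notin U by rewrite fU.
have [g [g0 gU gE]] := hyperplane_minors N0 (vbasisP _) dimU v0U.
have fg := kernel_scalar_proportional (f := f) (g := g) f0.
exists (g v0 / f v0) => [|i]; first by rewrite mulf_neq0 ?invr_eq0.
apply: (etrans (gE _ _ (jP i))); rewrite [g _]fg; first by rewrite mulrCA.
by move=> v /eqP; rewrite -fU; apply: gU.
Qed.

End HyperplanePlucker.

(** * Closed sets of hyperplanes *)

Section HyperplaneZariski.

Variables (k : fieldType) (V : vectType k).
Local Notation N := (\dim {:V}).
Implicit Types (S : V -> Prop) (U : {vspace V}) (Z : {vspace V} -> Prop).

(** Containing [v] is a single linear equation on the Pluecker coordinates: up to a nonzero factor
    they are the values of [f] on a basis, from which [f v] is recovered linearly. *)
Lemma zariski_closed_hyperplanes_containing S : (0 < N)%N ->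
  zariski_closed N.-1 (fun U => Gr N.-1 U /\ forall v, S v -> v \in U).
Proof.
move=> N0; have [s [j [s2 j_surj plE]]] := plucker_hyperplane N0.
(* [i] is a section of [j]: for each basis vector, a Pluecker index that omits it. *)
have /fin_all_exists[i ji] := j_surj.
pose L v : {mpoly k[#|{: plucker_index V N.-1}|]} :=
  \sum_l (coord (vbasis {:V}) l v * s (i l)) *: 'X_(i l).
have LE U v : \dim U = N.-1 -> ((L v).@[plucker U] == 0) = (v \in U).
  move=> dimU; have [f [v0 f0] fU] := hyperplane_kernel N0 dimU.
  have [c c0 cE] := plE _ _ _ dimU f0 fU.
  suff -> : (L v).@[plucker U] = c * f v by rewrite mulf_eq0 (negPf c0) fU.
  rewrite [in RHS](coord_vbasis (memvf v)) !linear_sum mulr_sumr.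
  apply: eq_bigr => l _; rewrite /= mevalZ mevalXU cE ji linearZ /=.
  by rewrite mulrCA -!mulrA [s _ * (s _ * _)]mulrA s2 mul1r mulrCA.
exists (fun p => exists2 v, S v & p = L v) => [p [v _ ->]|U].
  exists 1%N; rewrite /L; apply: rpred_sum => l _; apply: rpredZ.
  by rewrite dhomogX /= mdeg1.
split=> [[dimU SU]|[dimU FU]]; split=> //.
  by move=> p [v /SU vU ->]; apply/eqP; rewrite LE.
by move=> v Sv; rewrite -LE // FU //; exists v.
Qed.

(** The union is cut out by the products of one equation from each side. *)
Lemma zariski_closedU m Z1 Z2 : zariski_closed m Z1 -> zariski_closed m Z2 ->
  zariski_closed m (fun U => Z1 U \/ Z2 U).
Proof.
move=> [F1 h1 E1] [F2 h2 E2].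
exists (fun p => exists f g, [/\ F1 f, F2 g & p = f * g]).
  move=> p [f [g [/h1[d df] /h2[e eg] ->]]].
  by exists (d + e)%N; apply: dhomogM.
move=> U; split=> [[/E1|/E2] [dimU FU]|[dimU FU]].
- by split=> // p [f [g [/FU f0 _ ->]]]; rewrite mevalM f0 mul0r.
- by split=> // p [f [g [_ /FU g0 ->]]]; rewrite mevalM g0 mulr0.
have [Z2U|nZ2] := classic (Z2 U); first by right.
left; apply/E1; split=> // f Ff; apply/eqP/negPn/negP => f0.
case: nZ2; apply/E2; split=> // g Fg; apply/eqP; move: f0.
apply: contraNT => g0; rewrite -(mulIr_eq0 _ (mulIf g0)) -mevalM FU //.
by exists f, g.
Qed.

Lemma zariski_irreducible_cover m (A : {vspace V} -> Prop) (T : eqType)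
    (r : seq T) (Z : T -> {vspace V} -> Prop) :
  zariski_irreducible m A -> (forall t, zariski_closed m (Z t)) ->
  (forall U, A U -> exists2 t, t \in r & Z t U) ->
  exists2 t, t \in r & forall U, A U -> Z t U.
Proof.
move=> [[U0 AU0] irrA] clZ.
have cl (s : seq T) : zariski_closed m (fun U => exists2 t, t \in s & Z t U).
  elim: s => [|t s IHs]; last first.
    have [G hG GE] := zariski_closedU (clZ t) IHs.
    exists G => // U; rewrite -GE; split=> [[u]|[ZU|[u us ZU]]].
    - by rewrite inE => /orP[/eqP->|us] ZU; [left|right; exists u].
    - by exists t; rewrite ?mem_head.
    - by exists u; rewrite ?inE ?us ?orbT.
  (* The empty union is cut out by the constant 1, homogeneous of degree 0. *)
  exists (fun p => p = 1) => [p ->|U]; first by exists 0%N; apply: dhomog1.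
  by split=> [[]//|[_ /(_ _ erefl)/eqP]]; rewrite meval1 oner_eq0.
elim: r => [|t r IHr] Ar; first by have [] := Ar _ AU0.
have [U AU||h] := irrA _ _ (clZ t) (cl r).
- have [u] := Ar _ AU; rewrite inE => /orP[/eqP->|us] ZU; first by left.
  by right; exists u.
- by exists t; rewrite ?mem_head.
by have [u ur AZ] := IHr h; exists u; rewrite ?inE ?ur ?orbT.
Qed.

End HyperplaneZariski.

(** * Irreducibility of linear sections *)

Lemma meval_dhomogZ (R : comNzRingType) n d (p : {mpoly R[n]}) c v :
  p \is d.-homog -> p.@[fun i => c * v i] = c ^+ d * p.@[v].
Proof.
move=> /dhomogP hp; rewrite !mevalE mulr_sumr !big_seq; apply: eq_bigr => m mp.
rewrite mulrCA; congr (_ * _).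
under eq_bigr do rewrite exprMn.
by rewrite big_split /= prodrXr -(hp m mp) /= mdegE.
Qed.

Lemma horner_mmap_polyC (R : comNzRingType) n (p : {mpoly R[n]})
    (q : 'I_n -> {poly R}) x :
  (mmap polyC q p).[x] = p.@[fun i => (q i).[x]].
Proof.
rewrite /mmap mevalE horner_sum; apply: eq_bigr => m _.
rewrite hornerM hornerC horner_prod; congr (_ * _).
by apply: eq_bigr => i _; rewrite horner_exp.
Qed.

(** A linear section contains the line joining any two of its points. If [U1] is outside [Z1] and
    [U2] outside [Z2], an equation of each restricts to a nonzero polynomial on the line from [U1]
    to [U2]; a common non-root is a point of [A] outside both. *)
Lemma zariski_irreducible_hyperplanes_containing (k : closedFieldType)
    (V : vectType k) (S : V -> Prop) (A : {vspace V} -> Prop) :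
  (0 < \dim {:V})%N ->
  (forall U, A U <-> Gr (\dim {:V}).-1 U /\ forall v, S v -> v \in U) ->
  (exists U, A U) -> zariski_irreducible (\dim {:V}).-1 A.
Proof.
move=> N0 AE neA; split=> // Z1 Z2 [F1 h1 E1] [F2 h2 E2] cov.
apply: NNPP => /not_or_and[/not_all_ex_not[U1 nU1] /not_all_ex_not[U2 nU2]].
have [AU1 nZ1] := imply_to_and _ _ nU1; have [AU2 nZ2] := imply_to_and _ _ nU2.
have [s [j [s2 _ plE]]] := plucker_hyperplane N0.
have separate (F : _ -> Prop) Z U : A U ->
    (forall U, Z U <->
      Gr (\dim {:V}).-1 U /\ forall f, F f -> f.@[plucker U] = 0) -> ~ Z U ->
    exists2 f, F f & f.@[plucker (m := (\dim {:V}).-1) U] != 0.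
  move=> /AE[dimU _] ZE nZU; apply: NNPP => nF.
  apply: nZU; apply/ZE; split=> // f Ff.
  by apply/eqP/negPn/negP => f0; apply: nF; exists f.
have [p1 Fp1 p1U] := separate _ _ _ AU1 E1 nZ1.
have [p2 Fp2 p2U] := separate _ _ _ AU2 E2 nZ2.
have [dimU1 SU1] := (AE U1).1 AU1; have [dimU2 SU2] := (AE U2).1 AU2.
have [f1 [v1 f1v] f1U] := hyperplane_kernel N0 dimU1.
have [f2 [v2 f2v] f2U] := hyperplane_kernel N0 dimU2.
(* The hyperplanes on the line joining [U1] to [U2]. *)
pose fl x v := (1 - x) * f1 v + x * f2 v.
have lin_fl x : scalar (fl x) by move=> c u v; rewrite /fl !linearP /=; ring.
pose f x := HB.pack (fl x) (GRing.isLinear.Build k V k *%R (fl x) (lin_fl x))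
  : {scalar V}.
(* The Pluecker coordinates along the line as polynomials in the parameter, up to a common factor
   that homogeneity makes harmless. *)
pose q i : {poly k} := (s i *: ((1 - 'X) * (f1 (vbasis {:V})`_(j i))%:P
  + 'X * (f2 (vbasis {:V})`_(j i))%:P)).
have qE i x : (q i).[x] = s i * f x (vbasis {:V})`_(j i).
  by rewrite /q !hornerE.
have key p d x U v0 : p \is d.-homog -> \dim U = (\dim {:V}).-1 ->
    f x v0 != 0 -> kernel_of (f x) U ->
    ((mmap polyC q p).[x] == 0) = (p.@[plucker U] == 0).
  move=> hp dimU f0 fU; have [c c0 cE] := plE _ _ _ dimU f0 fU.
  rewrite (meval_eq p cE) (meval_dhomogZ _ _ hp) mulf_eq0 expf_eq0.
  rewrite (negPf c0) andbF /=.
  by rewrite horner_mmap_polyC (meval_eq p (fun i => qE i x)).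
have [d1 d1p] := h1 _ Fp1; have [d2 d2p] := h2 _ Fp2.
have q1 : (mmap polyC q p1).[0] != 0.
  by rewrite (key _ _ _ U1 v1 d1p) // => [|v]; rewrite [f _ _]/(fl _ _) /fl;
    rewrite subr0 mul1r mul0r addr0.
have q2 : (mmap polyC q p2).[1] != 0.
  by rewrite (key _ _ _ U2 v2 d2p) // => [|v]; rewrite [f _ _]/(fl _ _) /fl;
    rewrite subrr mul0r mul1r add0r.
(* The parameters 0 and 1 give [U1] and [U2], so neither factor is the zero polynomial. *)
have /closed_nonrootP[x] : mmap polyC q p1 * mmap polyC q p2 != 0.
  by apply: mulf_neq0; [apply: contraNneq q1 | apply: contraNneq q2] => ->;
    rewrite horner0.
rewrite /root hornerM mulf_eq0 negb_or => /andP[x1 x2].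
(* At the chosen parameter [f x] could vanish identically. Then [f1] and [f2] are proportional, so
   [U1 = U2] lies in neither closed set. *)
have [[v0 f0]|fx0] := classic (exists v0, f x v0 != 0).
  have [U fU dimU] := kernel_of_scalar f0.
  have AU : A U.
    apply/AE; split=> // v Sv; rewrite fU [f _ _]/(fl _ _) /fl.
    have := SU1 _ Sv; have := SU2 _ Sv; rewrite f1U f2U => /eqP-> /eqP->.
    by rewrite !mulr0 addr0.
  case: (cov _ AU) => [/E1|/E2] [_ Fp].
    by move: x1; rewrite (key _ _ _ _ _ d1p dimU f0 fU) Fp ?eqxx.
  by move: x2; rewrite (key _ _ _ _ _ d2p dimU f0 fU) Fp ?eqxx.
have fx v : (1 - x) * f1 v + x * f2 v = 0.
  by apply/eqP/negPn/negP => fv; apply: fx0; exists v.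
have xn0 : x != 0.
  by apply: contraNneq f1v => x0; rewrite -(fx v1) x0 subr0 mul1r mul0r addr0.
have U12 : U1 = U2.
  apply/eqP; rewrite eqEdim dimU1 dimU2 leqnn andbT; apply/subvP => v.
  rewrite f1U f2U => /eqP f1v0; have /eqP := fx v.
  by rewrite f1v0 mulr0 add0r mulf_eq0 (negPf xn0).
by case: (cov _ AU1) => [|]; [exact: nZ1 | rewrite U12].
Qed.

(** * Subalgebras of codimension one *)

Section BasicAlgebra.

Variables (k : fieldType) (B : falgType k).
Variables (T : finType) (chi : T -> {scalar B}).
Hypotheses (chiM : forall x a b, chi x (a * b) = chi x a * chi x b)
  (chi1 : forall x, chi x 1 = 1)
  (chi_nil : forall b, (forall x, chi x b = 0) -> exists n, b ^+ n = 0).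
Implicit Types (f : {scalar B}) (U : {vspace B}) (x y u v : T) (a b : B).
Local Notation N := (\dim {:B}).

Definition chi_derivation x y (f : B -> k) :=
  forall a b, f (a * b) = chi x a * f b + f a * chi y b.

(** If [c] differed from every [chi x] at some [a x] in [U], the product of the elements
    [a x - chi x (a x)] would be killed by all the characters, hence nilpotent, while [c] is nonzero
    on it and on its powers. *)
Lemma subalgebra_character U (c : {scalar B}) : 1 \in U -> (U * U <= U)%VS ->
  c 1 = 1 -> {in U &, forall a b, c (a * b) = c a * c b} ->
  exists x, {in U, c =1 chi x}.
Proof.
move=> U1 UU c1 cM; apply: NNPP => nx.
have /fin_all_exists[a aP] x : exists a, a \in U /\ c a != chi x a.
  apply: NNPP => na; apply: nx; exists x => a aU; apply/eqP/negPn/negP => ca.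
  by apply: na; exists a.
pose d x := a x - (chi x (a x))%:A.
have dU x : d x \in U by rewrite rpredB ?rpredZ //; case: (aP x).
have UM b b' : b \in U -> b' \in U -> b * b' \in U.
  by move=> bU b'U; apply: (subvP UU); apply: memv_mul.
pose w := \prod_x d x.
have [wU cw] : w \in U /\ c w != 0.
  rewrite /w; elim: (index_enum T) => [|x r [rU cr]].
    by rewrite big_nil U1 c1 oner_neq0.
  rewrite big_cons UM // cM // mulf_neq0 // linearB scalarZ c1 mulr1 subr_eq0.
  by case: (aP x).
have [n wn0] : exists n, w ^+ n = 0.
  apply: chi_nil => y; rewrite /w (big_morph (chi y) (chiM y) (chi1 y)).
  by rewrite (bigD1 y) //= linearB scalarZ chi1 mulr1 subrr mul0r.
have [wnU cwn] : w ^+ n \in U /\ c (w ^+ n) != 0.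
  elim: n {wn0} => [|n [wnU cwn]]; first by rewrite expr0 U1 c1 oner_neq0.
  by rewrite exprS UM // cM // mulf_neq0.
by rewrite wn0 linear0 eqxx in cwn.
Qed.

Lemma hyperplane_subalgebra_derivation f U b0 : f b0 = 1 -> kernel_of f U ->
  1 \in U -> (U * U <= U)%VS -> exists x y, chi_derivation x y f.
Proof.
move=> fb0 fU U1 UU.
have UM a b : a \in U -> b \in U -> a * b \in U.
  by move=> aU bU; apply: (subvP UU); apply: memv_mul.
have f0 a : a \in U -> f a = 0 by rewrite fU => /eqP.
have redU b1 b : f b1 = 1 -> b - f b *: b1 \in U.
  by move=> fb1; rewrite fU linearB scalarZ fb1 mulr1 subrr.
have split1 b1 b : b = (b - f b *: b1) + f b *: b1 by rewrite subrK.
have fl a b : a \in U -> f (a * b) = f (a * b0) * f b.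
  move=> aU; rewrite {1}(split1 b0 b) mulrDr linearD /= f0 ?UM ?redU //.
  by rewrite add0r -scalerAr scalarZ mulrC.
have fr a b : a \in U -> f (b * a) = f b * f (b0 * a).
  move=> aU; rewrite {1}(split1 b0 b) mulrDl linearD /= f0 ?UM ?redU //.
  by rewrite add0r -scalerAl scalarZ.
(* [c1] and [c2] are the characters through which [U] acts on [B/U]. *)
pose c1 a := f (a * b0); pose c2 a := f (b0 * a).
have lin_c1 : scalar c1 by move=> c a b; rewrite /c1 mulrDl -scalerAl linearP.
have lin_c2 : scalar c2 by move=> c a b; rewrite /c2 mulrDr -scalerAr linearP.
have [x cx] := @subalgebra_character U
  (HB.pack c1 (GRing.isLinear.Build k B k *%R c1 lin_c1)) U1 UU
  (etrans (congr1 f (mul1r b0)) fb0)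
  (fun a b aU bU => etrans (congr1 f (esym (mulrA a b b0))) (fl a _ aU)).
have [y cy] := @subalgebra_character U
  (HB.pack c2 (GRing.isLinear.Build k B k *%R c2 lin_c2)) U1 UU
  (etrans (congr1 f (mulr1 b0)) fb0)
  (fun a b aU bU => etrans (congr1 f (mulrA b0 a b)) (fr b _ bU)).
have {cx}fl a b : a \in U -> f (a * b) = chi x a * f b.
  by move=> aU; rewrite fl // -cx.
have {cy}fr a b : a \in U -> f (b * a) = f b * chi y a.
  by move=> aU; rewrite fr // -cy.
(* Split [a] and [b] along [U] and the line of [b1]. Only [f (b1 * b1)] then remains to be
   determined. *)
have fM b1 a b : f b1 = 1 -> f (a * b) = f a * f b * f (b1 * b1)
    + f a * (chi y b - f b * chi y b1) + (chi x a - f a * chi x b1) * f b.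
  move=> fb1; have := redU _ a fb1; have := redU _ b fb1.
  have := split1 b1 a; have := split1 b1 b.
  move: (a - _) (b - _) => a' b' Eb Ea b'U a'U.
  have -> : f (a * b)
      = f a * f b * f (b1 * b1) + f a * chi y b' + chi x a' * f b.
    rewrite {1}Eb {1}Ea mulrDl !mulrDr !linearD /= f0 ?UM // fl //.
    rewrite -!scalerAl -!scalerAr !scalarZ [f (b1 * b')]fr // fb1; ring.
  have -> : chi y b' = chi y b - f b * chi y b1.
    by rewrite [in chi y b]Eb linearD scalarZ addrK.
  by rewrite [in chi x a]Ea linearD scalarZ addrK.
have [[b1 fb1 xy]|nxy] := classic (exists2 b1, f b1 = 1 & chi x b1 != chi y b1).
  exists x, y => a b; rewrite (fM b1) //.
  (* Computing [f (b1 ^+ 3)] in two ways. *)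
  have cube : f (b1 * (b1 * b1)) = f (b1 * b1 * b1) by rewrite mulrA.
  have sq : f (b1 * b1) = chi x b1 + chi y b1.
    rewrite (fM b1) // [in RHS](fM b1) // !chiM fb1 in cube.
    have : (chi x b1 - chi y b1) * (f (b1 * b1) - (chi x b1 + chi y b1)) = 0.
      by move/eqP: cube; rewrite -subr_eq0 => /eqP <-; ring.
    by move/eqP; rewrite mulf_eq0 !subr_eq0 (negPf xy) => /eqP.
  by rewrite sq; ring.
have xy b : chi x b = chi y b.
  have eq1 b1 : f b1 = 1 -> chi x b1 = chi y b1.
    (* Equality of the characters passes from the affine hyperplane [f = 1] to all of [B]: for any
       [b], the element [b0 + (b - f b *: b0)] lies on it. *)
    by move=> fb1; apply/eqP/negPn/negP => nb; apply: nxy; exists b1.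
  have := eq1 (b0 + (b - f b *: b0)).
  rewrite !linearD !linearN /= !scalarZ (eq1 _ fb0) fb0 mulr1 subrr addr0.
  by move=> /(_ erefl)/addrI/addIr.
(* The characters on both sides agree; the other extension of [chi x] from [U]
   to [B], perhaps equal to it, is [chi x + d f]. *)
pose d := f (b0 * b0) - chi x b0 *+ 2.
have {}fM a b : f (a * b) = d * (f a * f b) + f a * chi x b + chi x a * f b.
  by rewrite (fM b0) // -!xy /d; ring.
pose c a := chi x a + d * f a.
have lin_c : scalar c by move=> z a b; rewrite /c !linearP /=; ring.
have [||z cz] := @subalgebra_character fullv
  (HB.pack c (GRing.isLinear.Build k B k *%R c lin_c)) (memvf _) (subvf _).
- by rewrite /= /c chi1 f0 // mulr0 addr0.
- by move=> a b _ _; rewrite /= /c chiM fM; ring.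
exists z, x => a b; rewrite -cz ?memvf //= /c fM; ring.
Qed.

Lemma kernel_of_derivation_subalgebra x y f U :
  chi_derivation x y f -> kernel_of f U -> 1 \in U /\ (U * U <= U)%VS.
Proof.
move=> Df fU; split.
  (* The rule at [1 * 1] reads [f 1 = f 1 + f 1], so [f 1 = 0]. *)
  have := Df 1 1; rewrite !chi1 mulr1 mul1r mulr1 => /eqP.
  by rewrite -subr_eq0 opprD addrA subrr sub0r oppr_eq0 fU.
apply/prodvP => a b; rewrite !fU => /eqP fa /eqP fb.
by rewrite Df fa fb mulr0 mul0r addr0.
Qed.

(** These vectors do not depend on [f], so being an (x, y)-derivation becomes the linear condition
    that the kernel contains them all. *)
Definition derivation_relation x y b :=
  exists a a', b = a * a' - chi x a *: a' - chi y a' *: a.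

Lemma chi_derivationP x y f U : kernel_of f U ->
  (chi_derivation x y f <-> forall b, derivation_relation x y b -> b \in U).
Proof.
move=> fU; split=> [Df _ [a [b ->]]|DU a b].
  by rewrite fU !linearB /= !scalarZ Df; apply/eqP; ring.
have := DU _ (ex_intro _ a (ex_intro _ b erefl)).
rewrite fU !linearB /= !scalarZ -addrA -opprD subr_eq0 => /eqP ->.
by rewrite [f a * _]mulrC.
Qed.

Lemma dim_falg_gt0 : (0 < N)%N.
Proof.
rewrite lt0n dimv_eq0; apply/eqP => B0; have := memvf (1 : B).
by rewrite B0 memv0 oner_eq0.
Qed.

Lemma AlgGr_derivation U : AlgGr B N.-1 U ->
  exists f, [/\ exists b, f b != 0, kernel_of f U
             & exists x y, chi_derivation x y f].
Proof.
move=> [dimU U1 UU]; have [f [b fb] fU] := hyperplane_kernel dim_falg_gt0 dimU.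
exists f; split=> //; first by exists b.
apply: (@hyperplane_subalgebra_derivation _ U ((f b)^-1 *: b)) => //.
by rewrite scalarZ mulVf.
Qed.

Lemma derivation_AlgGr x y f b : chi_derivation x y f -> f b != 0 ->
  exists2 U, AlgGr B N.-1 U & kernel_of f U.
Proof.
move=> Df fb; have [U fU dimU] := kernel_of_scalar fb.
by exists U => //; have [U1 UU] := kernel_of_derivation_subalgebra Df fU.
Qed.

(** The pairs (x, y) index a finite closed cover of [AlgGr]; by irreducibility one member is
    everything. *)
Lemma AlgGr_irreducible_derivation :
  zariski_irreducible N.-1 (AlgGr B N.-1) ->
  exists x y, (exists f b, chi_derivation x y f /\ f b != 0) /\
    forall u v f, chi_derivation u v f -> chi_derivation x y f.
Proof.
move=> irr; have [[U0 AU0] _] := irr.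
pose Z (p : T * T) U :=
  Gr N.-1 U /\ forall b, derivation_relation p.1 p.2 b -> b \in U.
have [|U AU|[x y] _ AZ] := zariski_irreducible_cover
  (r := enum {: T * T}) (Z := Z) irr.
- by move=> p; apply: zariski_closed_hyperplanes_containing dim_falg_gt0.
- have [f [_ fU [x [y Df]]]] := AlgGr_derivation AU.
  exists (x, y); rewrite ?mem_enum //; split; first by case: AU.
  exact: (chi_derivationP x y fU).1.
have sub u v f : chi_derivation u v f -> chi_derivation x y f.
  move=> Df; have [[b fb]|f0] := classic (exists b, f b != 0).
    have [U AU fU] := derivation_AlgGr Df fb.
    by apply/(chi_derivationP x y fU); case: (AZ _ AU).
  (* The zero functional defines no hyperplane, but it is a derivation for every pair. *)
  have {}f0 b : f b = 0 by apply/eqP/negPn/negP => fb; apply: f0; exists b.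
  by move=> a b; rewrite !f0 mulr0 mul0r addr0.
exists x, y; split=> //.
have [f [[b fb] _ [u [v Df]]]] := AlgGr_derivation AU0.
by exists f, b; split=> //; apply: sub Df.
Qed.

End BasicAlgebra.

(** When the derivations for (x, y) include all others, [AlgGr] is a single linear section, and [f]
    provides a point of it. *)
Lemma derivation_AlgGr_irreducible (k : closedFieldType) (B : falgType k)
    (T : finType) (chi : T -> {scalar B}) x y (f : {scalar B}) b :
  (forall x a b, chi x (a * b) = chi x a * chi x b) ->
  (forall x, chi x 1 = 1) ->
  (forall b, (forall x, chi x b = 0) -> exists n, b ^+ n = 0) ->
  chi_derivation chi x y f -> f b != 0 ->
  (forall u v (g : {scalar B}),
    chi_derivation chi u v g -> chi_derivation chi x y g) ->
  zariski_irreducible (\dim {:B}).-1 (AlgGr B (\dim {:B}).-1).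
Proof.
move=> chiM chi1 chi_nil Df fb sub.
apply: (@zariski_irreducible_hyperplanes_containing _ _
  (derivation_relation chi x y)).
- exact: dim_falg_gt0.
- move=> U; split=> [AU|[dimU DU]].
    have [g [_ gU [u [v Dg]]]] := AlgGr_derivation chiM chi1 chi_nil AU.
    split; first by case: AU.
    apply: (proj1 (chi_derivationP chi x y gU)); exact: sub Dg.
  have [g [c gc] gU] := hyperplane_kernel (dim_falg_gt0 B) dimU.
  have Dg := (chi_derivationP chi x y gU).2 DU.
  by have [] := kernel_of_derivation_subalgebra chi1 Dg gU.
by have [U] := derivation_AlgGr chi1 Df fb; exists U.
Qed.

(** * Coefficients in the path algebra *)

Lemma scalarE (k : fieldType) (V : lmodType k) (u : V -> k) : scalar u ->
  [/\ u 0 = 0, forall a b : V, u (a + b) = u a + u b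
    & forall c (a : V), u (c *: a) = c * u a].
Proof.
move=> lin_u; have uD (a b : V) : u (a + b) = u a + u b.
  by rewrite -{1}[a]scale1r lin_u mul1r.
have u0 : u 0 = 0 by apply: (addrI (u 0)); rewrite -uD !addr0.
by split=> // c a; rewrite -[c *: a]addr0 lin_u u0 addr0.
Qed.

Section PathAlgebraCoefficients.

Variables (k : fieldType) (Q : quiver).
Local Notation kQ := (pathalg k Q).
Implicit Types (p q : qpath Q) (x y z : vertex Q) (al : arrow Q) (a b : kQ).

(* [u], [v], [d] are kept abstract: with [coeff] in their place, failed
   unifications unfold the quotient type [{freeg _ / _}]. *)
Lemma derivation_on_paths (u v d : kQ -> k) :
  scalar u -> scalar v -> scalar d ->
  (forall p q, d (path_mul k p q)
    = u (path_elt k p) * d (path_elt k q)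
      + d (path_elt k p) * v (path_elt k q)) ->
  forall a b, d (pathalg_mul a b) = u a * d b + d a * v b.
Proof.
move=> /scalarE[u0 uD uZ] /scalarE[v0 vD vZ] /scalarE[d0 dD dZ].
move=> h a b.
elim/pathalg_ind: a => [|a a' IH IH'|c a IH|p].
- by rewrite pathalg_mul0r d0 u0 !mul0r addr0.
- by rewrite pathalg_mulDl uD !dD IH IH' !mulrDl addrACA.
- by rewrite pathalg_mulZl uZ !dZ IH mulrDr !mulrA.
elim/pathalg_ind: b => [|b b' IH IH'|c b IH|q].
- by rewrite pathalg_mulr0 d0 v0 !mulr0 addr0.
- by rewrite pathalg_mulDr vD !dD IH IH' !mulrDr addrACA.
- by rewrite pathalg_mulZr vZ !dZ IH mulrDr !(mulrCA c).
by rewrite pathalg_mul_elt h.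
Qed.

Lemma path_eltM p q : path_elt k p * path_elt k q = path_mul k p q.
Proof. exact: pathalg_mul_elt. Qed.

Lemma coeff_path_elt p q : coeff p (path_elt k q) = (q == p)%:R.
Proof. by rewrite coeffU mul1r. Qed.

Lemma eq_trivial_path p x :
  (p == trivial_path x) = (parrows p == [::]) && (pstart p == x).
Proof.
apply/eqP/andP => [->|[/eqP p0 /eqP px]].
  by rewrite /parrows /pstart /= !eqxx.
apply: qpath_inj => //; have := qpathP p.
by rewrite p0 px /= => /eqP.
Qed.

Lemma eq_arrow_path p al : (p == arrow_path al) = (parrows p == [:: al]).
Proof.
apply/eqP/eqP => [->//|pa]; have := qpathP p.
rewrite pa /= => /andP[/eqP s /eqP t].
by apply: qpath_inj; rewrite ?s ?t.
Qed.

(** A concatenation of two paths is trivial at [x] only if both factors are. *)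
Lemma coeff_trivial_pathM x a b :
  coeff (trivial_path x) (pathalg_mul a b)
  = coeff (trivial_path x) a * coeff (trivial_path x) b.
Proof.
elim/pathalg_ind: a => [|a a' IH IH'|c a IH|p].
- by rewrite pathalg_mul0r coeff0 mul0r.
- by rewrite pathalg_mulDl 2!coeffD IH IH' mulrDl.
- by rewrite pathalg_mulZl 2!coeffZ IH mulrA.
elim/pathalg_ind: b => [|b b' IH IH'|c b IH|q].
- by rewrite pathalg_mulr0 coeff0 mulr0.
- by rewrite pathalg_mulDr 2!coeffD IH IH' mulrDr.
- by rewrite pathalg_mulZr 2!coeffZ IH mulrCA.
rewrite pathalg_mul_elt !coeff_path_elt /path_mul /Defs.pcomp !eq_trivial_path.
have := qpathP p; have := qpathP q.
case: (pend p =P pstart q) => [pq|npq].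
  rewrite coeff_path_elt eq_trivial_path -[parrows (pconcat _)]/(_ ++ _)
    -[pstart (pconcat _)]/(pstart p) -natrM mulnb.
  rewrite -pq; case: (parrows p) => [|al s] /=; last by [].
  by case: (parrows q) => [|be s] /= _ => [/eqP ->|]; rewrite ?andbb ?andbF.
rewrite [LHS]coeff0; case: (parrows p) => [|al s] /=; last by rewrite mul0r.
case: (parrows q) => [|be s] /=; last by rewrite mulr0.
move=> _ /eqP px; rewrite -natrM mulnb; case: eqP => // <-.
by rewrite px; case: eqP => // /esym.
Qed.

(** An arrow factors only as its source vertex followed by itself, or itself followed by its target
    vertex. *)
Lemma coeff_arrow_pathM al a b :
  coeff (arrow_path al) (pathalg_mul a b)
  = coeff (trivial_path (source al)) a * coeff (arrow_path al) b
    + coeff (arrow_path al) a * coeff (trivial_path (target al)) b.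
Proof.
move: a b; apply: derivation_on_paths => [c a b|c a b|c a b|p q].
- by rewrite coeffD coeffZ.
- by rewrite coeffD coeffZ.
- by rewrite coeffD coeffZ.
rewrite !coeff_path_elt /path_mul /Defs.pcomp !eq_trivial_path !eq_arrow_path.
have := qpathP p; have := qpathP q.
case: (pend p =P pstart q) => [pq|npq].
  rewrite coeff_path_elt eq_arrow_path -[parrows (pconcat _)]/(_ ++ _).
  rewrite -!natrM -natrD !mulnb.
  rewrite -pq; case: (parrows p) => [|be [|ga s]] /=.
  - rewrite addn0; case: (parrows q) => [|de [|ep s]] /=;
      rewrite ?eqseq_cons /= ?andbF //.
    rewrite andbT => /andP[/eqP de_q _] /eqP ->.
    by case: (de =P al) => [<-|_]; rewrite ?andbF // de_q eqxx.
  - case: (parrows q) => [|de s] /=.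
      move=> _ /andP[_ /eqP <-]; rewrite eqseq_cons andbT.
      by case: (be =P al) => [<-|_]; rewrite ?eqxx.
    by rewrite !eqseq_cons /= !andbF.
  by rewrite !eqseq_cons /= !andbF.
rewrite [LHS]coeff0 -!natrM -natrD !mulnb.
case: (parrows p) => [|be s] /=.
  rewrite addn0; case: (parrows q) => [|de [|ep s]] /=;
      rewrite ?eqseq_cons /= ?andbF //.
  rewrite andbT; move=> /andP[/eqP sde _] /eqP px.
  case: (de =P al) => [<-|_]; rewrite ?andbF //.
  by rewrite sde px; case: eqP npq.
case: (parrows q) => [|de t] /=; rewrite ?andbF //.
move=> _; case: s => [|ga s] /=; rewrite ?eqseq_cons /= ?andbF //.
move=> /andP[_ /eqP tbe]; rewrite andbT.
by case: (be =P al) => [<-|_] //; rewrite tbe eq_sym; case: eqP npq.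
Qed.

Lemma two_sided_idealZ (I : kQ -> Prop) c a :
  two_sided_ideal I -> I a -> I (c *: a).
Proof.
move=> [_ _ IM _] Ia.
have -> : c *: a = pathalg_mul (c *: pathalg_one k Q) a.
  by rewrite pathalg_mulZl pathalg_mul1.
exact: IM.
Qed.

Lemma path_elt_cons p al s : parrows p = al :: s ->
  exists q, path_elt k p = path_elt k (arrow_path al) * path_elt k q.
Proof.
move=> pE; have := qpathP p; rewrite pE /= => /andP[/eqP sal w].
exists (exist _ (target al, s, pend p) w).
by rewrite path_eltM /path_mul (pcompE (r := p)).
Qed.

(** The elements without trivial paths form an ideal containing the arrows, which gives one
    direction. For the other, every nontrivial path starts with an arrow and so lies in any such
    ideal. *)
Lemma arrow_idealP a :
  arrow_ideal a <-> forall x, coeff (trivial_path x) a = 0.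
Proof.
split=> [Ja|a0 I hI Iarr].
  apply: (Ja (fun a => forall x, coeff (trivial_path x) a = 0)) => [|al x].
    split=> [x|b c b0 c0 x|b c c0 x|b c b0 x].
    - by rewrite coeff0.
    - by rewrite coeffD b0 c0 addr0.
    - by rewrite [LHS]coeff_trivial_pathM c0 mulr0.
    - by rewrite [LHS]coeff_trivial_pathM b0 mul0r.
  by rewrite coeff_path_elt eq_trivial_path.
rewrite -[a]fglift_id fgliftE; have [I0 ID _ IM] := hI.
elim/big_ind: _ => // p _; case pE: (parrows p) => [|al s].
  suff -> : coeff p a = 0 by rewrite scale0r.
  rewrite -(a0 (pstart p)); congr coeff; apply/eqP.
  by rewrite eq_trivial_path pE !eqxx.
apply: two_sided_idealZ => //; have [q] := path_elt_cons pE.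
by rewrite /path_elt => ->; apply/IM/Iarr.
Qed.

Lemma arrow_ideal_exp2 a : ideal_exp (@arrow_ideal k Q) 2 a ->
  (forall x, coeff (trivial_path x) a = 0) /\
  (forall al, coeff (arrow_path al) a = 0).
Proof.
case=> s sJ ->.
(* The square unfolds to the arrow ideal times (the arrow ideal times everything), so the second
   factor still has no trivial paths. *)
have {}sJ u : u \in s -> forall x,
    coeff (trivial_path x) u.1 = 0 /\ coeff (trivial_path x) u.2 = 0.
  move=> /sJ [/arrow_idealP u1 [t tJ u2]] x; split=> //; rewrite u2 raddf_sum.
  rewrite big_seq big1 // => v /tJ [/arrow_idealP v1 _].
  by rewrite [LHS]coeff_trivial_pathM v1 mul0r.
split=> [x|al]; rewrite raddf_sum big_seq big1 // => u us.
  by rewrite [LHS]coeff_trivial_pathM (sJ u us x).1 mul0r.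
by rewrite [LHS]coeff_arrow_pathM (sJ u us _).1 (sJ u us _).2 mul0r mulr0 addr0.
Qed.

Lemma arrow_ideal_exprn a n :
  arrow_ideal a -> ideal_exp (@arrow_ideal k Q) n (a ^+ n).
Proof.
move=> Ja; elim: n => [//|n IHn]; exists [:: (a, a ^+ n)].
  by move=> u; rewrite inE => /eqP ->.
by rewrite big_seq1 exprS.
Qed.

End PathAlgebraCoefficients.

(** * Derivations of an admissible quotient *)

Lemma scalar_bundle (k : fieldType) (V : lmodType k) (h : V -> k) :
  scalar h -> exists f : {scalar V}, f =1 h.
Proof.
move=> lin_h.
by exists (HB.pack h (GRing.isLinear.Build k V k *%R h lin_h) : {scalar V}).
Qed.

Section AdmissibleQuotient.

Variables (k : fieldType) (Q : quiver) (I : pathalg k Q -> Prop).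
Hypothesis hI : admissible I.
Variables (B : falgType k) (pi : {rmorphism pathalg k Q -> B}).
Hypotheses (pi_scalable : scalable pi)
  (pi_surj : forall b : B, exists a : pathalg k Q, pi a = b)
  (pi_ker : forall a : pathalg k Q, pi a = 0 <-> I a).
Implicit Types (p q : qpath Q) (x y z : vertex Q) (al : arrow Q)
  (a : pathalg k Q) (b : B) (f g : {scalar B}).

Lemma coeff_quotient p : (forall a, I a -> coeff p a = 0) ->
  exists f, forall a, f (pi a) = coeff p a.
Proof.
move=> pI.
have surj b : exists a, pi a == b by have [a <-] := pi_surj b; exists a.
pose s b := xchoose (surj b).
have sK b : pi (s b) = b by apply/eqP; apply: (xchooseP (surj b)).
have wd a a' : pi a = pi a' -> coeff p a = coeff p a'.
  move=> aa; apply/eqP; rewrite -subr_eq0 -coeffB; apply/eqP/pI/pi_ker.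
  by rewrite raddfB /= aa subrr.
have [|f fE] := @scalar_bundle k B (fun b => coeff p (s b)).
  move=> c b b'; rewrite -coeffZ -coeffD; apply: wd.
  by rewrite raddfD /= pi_scalable !sK.
by exists f => a; rewrite fE; apply: wd; rewrite sK.
Qed.

Lemma quotient_characters : exists chi : vertex Q -> {scalar B},
  forall x a, chi x (pi a) = coeff (trivial_path x) a.
Proof.
apply: (fin_all_exists (P := fun x f =>
  forall a, f (pi a) = coeff (trivial_path x) a)) => x.
apply: coeff_quotient => a; have [_ I2 _] := hI.
by move=> /I2/arrow_ideal_exp2[].
Qed.

Lemma quotient_arrow_functional al :
  exists f, forall a, f (pi a) = coeff (arrow_path al) a.
Proof.
apply: coeff_quotient => a; have [_ I2 _] := hI.
by move=> /I2/arrow_ideal_exp2[].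
Qed.

Variable chi : vertex Q -> {scalar B}.
Hypothesis chiE : forall x a, chi x (pi a) = coeff (trivial_path x) a.

Lemma quotient_characterM x b b' : chi x (b * b') = chi x b * chi x b'.
Proof.
have [a <-] := pi_surj b; have [a' <-] := pi_surj b'.
by rewrite -rmorphM !chiE [LHS]coeff_trivial_pathM.
Qed.

Definition pi_vertex x := pi (path_elt k (trivial_path x)).
Definition pi_arrow al := pi (path_elt k (arrow_path al)).

Lemma quotient_character_vertex x y : chi x (pi_vertex y) = (y == x)%:R.
Proof. by rewrite chiE coeff_path_elt eq_trivial_path. Qed.

Lemma quotient_character_arrow x al : chi x (pi_arrow al) = 0.
Proof. by rewrite chiE coeff_path_elt eq_trivial_path. Qed.

Lemma quotient_character1 x : chi x 1 = 1.
Proof.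
have -> : 1 = \sum_y pi_vertex y by rewrite -(rmorph1 pi) -raddf_sum.
rewrite linear_sum (bigD1 x) //= quotient_character_vertex eqxx.
rewrite big1 ?addr0 // => y yx.
by rewrite quotient_character_vertex (negPf yx).
Qed.

(** A lift of [b] lies in the arrow ideal, and admissibility puts its [l]-th power in [I]. *)
Lemma quotient_character_nil b :
  (forall x, chi x b = 0) -> exists n, b ^+ n = 0.
Proof.
have [a <-] := pi_surj b => a0; have [_ _ [l _ Jl]] := hI.
exists l; rewrite -rmorphXn.
apply/pi_ker/Jl/arrow_ideal_exprn/arrow_idealP => x.
by rewrite -chiE.
Qed.

Lemma pi_vertexM x y : x != y -> pi_vertex x * pi_vertex y = 0.
Proof.
move=> /eqP xy; rewrite -rmorphM path_eltM /path_mul pcomp_None //.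
exact: raddf0.
Qed.

Lemma pi_vertex_idem x : pi_vertex x * pi_vertex x = pi_vertex x.
Proof.
by rewrite -rmorphM path_eltM /path_mul (pcompE (r := trivial_path x)).
Qed.

Lemma pi_source_arrow al : pi_vertex (source al) * pi_arrow al = pi_arrow al.
Proof.
by rewrite -rmorphM path_eltM /path_mul (pcompE (r := arrow_path al)).
Qed.

Lemma pi_arrow_target al : pi_arrow al * pi_vertex (target al) = pi_arrow al.
Proof.
by rewrite -rmorphM path_eltM /path_mul (pcompE (r := arrow_path al)).
Qed.

Lemma chi_derivation_diff x y : exists2 f : {scalar B},
  chi_derivation chi x y f & forall b, f b = chi x b - chi y b.
Proof.
have [|f fE] := @scalar_bundle k B (fun b => chi x b - chi y b).
  by move=> c b b'; rewrite !linearP /=; ring.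
by exists f => // b b'; rewrite !fE !quotient_characterM; ring.
Qed.

Lemma chi_derivation_arrow al : exists2 f : {scalar B},
  chi_derivation chi (source al) (target al) f & f (pi_arrow al) = 1.
Proof.
have [f fE] := quotient_arrow_functional al.
exists f; last by rewrite fE coeff_path_elt eqxx.
move=> b b'; have [a <-] := pi_surj b; have [a' <-] := pi_surj b'.
by rewrite -rmorphM !fE !chiE [LHS]coeff_arrow_pathM.
Qed.

(** A nontrivial path is an arrow times a path. Both terms of the derivation rule vanish, as [chi x]
    and [f] kill the arrow, so no induction on the length is involved. *)
Lemma chi_derivation_eq0 x y f : chi_derivation chi x y f ->
  (forall z, f (pi_vertex z) = 0) -> (forall al, f (pi_arrow al) = 0) ->
  forall b, f b = 0.
Proof.
move=> Df fv fa b; have [a <-] := pi_surj b.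
elim/pathalg_ind: a => [|a a' IH IH'|c a IH|p]; first by rewrite raddf0 linear0.
- by rewrite raddfD linearD /= IH IH' addr0.
- by rewrite pi_scalable scalarZ IH mulr0.
case pE: (parrows p) => [|al s].
  suff -> : p = trivial_path (pstart p) by apply: fv.
  by apply/eqP; rewrite eq_trivial_path pE !eqxx.
have [q ->] := path_elt_cons k pE.
by rewrite rmorphM Df -/(pi_arrow al) fa quotient_character_arrow !mul0r addr0.
Qed.

(** Apply the rule to the idempotent at [z]: for [z = x] the value equals its own double, otherwise
    both terms are zero. *)
Lemma chi_derivation_loop_vertex x z f :
  chi_derivation chi x x f -> f (pi_vertex z) = 0.
Proof.
move=> Df; have := Df (pi_vertex z) (pi_vertex z).
rewrite pi_vertex_idem quotient_character_vertex.
case: eqP => _; last by rewrite mul0r mulr0 addr0.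
rewrite mul1r mulr1 => /eqP.
by rewrite -subr_eq0 opprD addrA subrr sub0r oppr_eq0 => /eqP.
Qed.

Lemma chi_derivation_distinct_vertex x y z f :
  chi_derivation chi x y f -> z != x -> z != y -> f (pi_vertex z) = 0.
Proof.
move=> Df zx zy; rewrite -pi_vertex_idem Df !quotient_character_vertex.
by rewrite (negPf zx) (negPf zy) mul0r mulr0 addr0.
Qed.

Lemma chi_derivation_arrow_ends x y al f :
  chi_derivation chi x y f -> f (pi_arrow al) != 0 ->
  source al = x /\ target al = y.
Proof.
move=> Df fal; split; apply/eqP; apply: contraNT fal => ne.
  rewrite -pi_source_arrow Df quotient_character_vertex (negPf ne) mul0r.
  by rewrite quotient_character_arrow mulr0 addr0.
rewrite -pi_arrow_target Df quotient_character_vertex (negPf ne) mulr0.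
by rewrite quotient_character_arrow mul0r addr0.
Qed.

(** An additional vertex [z] is excluded by testing [chi x - chi z] on vertices, and a misplaced
    arrow by testing its coefficient functional. If [x = y], an arrow must exist, since otherwise
    [f] would vanish. *)
Lemma dominating_derivations_quiver x y f b :
  chi_derivation chi x y f -> f b != 0 ->
  (forall u v g, chi_derivation chi u v g -> chi_derivation chi x y g) ->
  [\/ exists2 m : nat, (1 <= m)%N & is_loop_quiver m Q,
      exists2 m : nat, (1 <= m)%N & is_kronecker_quiver m Q
    | is_two_isolated_vertices Q].
Proof.
move=> Df fb sub.
have [xy|xy] := eqVneq x y.
  rewrite -xy in Df sub; constructor 1.
  have vx z : z = x.
    apply/eqP/negPn/negP => zx; have [g Dg gE] := chi_derivation_diff x z.
    have := chi_derivation_loop_vertex x (sub _ _ _ Dg).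
    rewrite gE !quotient_character_vertex eqxx eq_sym (negPf zx) subr0 => /eqP.
    by rewrite oner_eq0.
  exists #|arrow Q|; last first.
    split=> //; rewrite -(card1 x); apply: eq_card => z.
    by rewrite !inE [z]vx eqxx.
  rewrite lt0n; apply: contraNneq fb => /card0_eq noarr.
  apply/eqP; apply: (chi_derivation_eq0 Df) => [z|al].
    exact: chi_derivation_loop_vertex Df.
  by have := noarr al; rewrite inE.
have vxy z : (z == x) || (z == y).
  apply/negPn/negP; rewrite negb_or => /andP[zx zy].
  have [g Dg gE] := chi_derivation_diff x z.
  have := chi_derivation_distinct_vertex (sub _ _ _ Dg) zx zy.
  rewrite gE !quotient_character_vertex eqxx (negPf zx) sub0r => /eqP.
  by rewrite oppr_eq0 oner_eq0.
have aE al : source al = x /\ target al = y.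
  have [g Dg gal] := chi_derivation_arrow al.
  by apply: (chi_derivation_arrow_ends (sub _ _ _ Dg)); rewrite gal oner_eq0.
have [a0|a0] := posnP #|arrow Q|; last first.
  by constructor 2; exists #|arrow Q| => //; exists x, y.
constructor 3; split=> //; transitivity #|pred2 x y|; last by rewrite card2 xy.
by apply: eq_card => z; rewrite !inE vxy.
Qed.

Lemma loop_quiver_dominating m : (1 <= m)%N -> is_loop_quiver m Q ->
  exists x f b, [/\ chi_derivation chi x x f, f b != 0
  & forall u v g, chi_derivation chi u v g -> chi_derivation chi x x g].
Proof.
move=> m1 [/eqP/fintype1P[x vx] am]; rewrite -am in m1.
have /card_gt0P[al _] := m1; have [f Df fal] := chi_derivation_arrow al.
exists x, f, (pi_arrow al); rewrite fal oner_neq0.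
split=> // [|u v g]; first by rewrite -{1}(vx (source al)) -(vx (target al)).
by rewrite (vx u) (vx v).
Qed.

(** Treats the Kronecker quivers and the two isolated vertices together. A derivation for a pair
    other than (s, t) kills all arrows; it is zero for equal characters and a multiple of
    [chi s - chi t] for (t, s). *)
Lemma bipartite_quiver_dominating s t : s != t ->
  (forall z, (z == s) || (z == t)) ->
  (forall al : arrow Q, source al = s /\ target al = t) ->
  exists f b, [/\ chi_derivation chi s t f, f b != 0
  & forall u v g, chi_derivation chi u v g -> chi_derivation chi s t g].
Proof.
move=> st vst ast; have [f Df fE] := chi_derivation_diff s t.
have ts : (t == s) = false by rewrite eq_sym (negPf st).
exists f, (pi_vertex s); split=> //.
  by rewrite fE !quotient_character_vertex eqxx (negPf st) subr0 oner_neq0.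
move=> u v g Dg.
have [[<- <-] //|nst] := eqVneq (u, v) (s, t).
have ga al : g (pi_arrow al) = 0.
  apply/eqP/negPn/negP => /(chi_derivation_arrow_ends Dg)[].
  by have [-> ->] := ast al => us vt; rewrite us vt eqxx in nst.
have [uv|uv] := eqVneq u v.
  rewrite -uv in Dg; have g0 := chi_derivation_eq0 Dg
    (fun z => chi_derivation_loop_vertex z Dg) ga.
  by move=> b b'; rewrite !g0 mulr0 mul0r addr0.
suff [c gE] : exists c, forall b, g b = c * (chi s b - chi t b).
  by move=> b b'; rewrite !gE !quotient_characterM; ring.
have [ut vs] : u = t /\ v = s.
  by case/orP: (vst u) uv nst => /eqP ->; case/orP: (vst v) => /eqP ->;
    rewrite ?eqxx.
rewrite {}ut {}vs in Dg.
exists (g (pi_vertex s)) => b.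
(* [chi s - chi t] is also a (t, s)-derivation, so the difference [h] is one too, and it suffices to
   check it on vertices and arrows. *)
have [|h hE] := @scalar_bundle k B
    (fun b => g b - g (pi_vertex s) * (chi s b - chi t b)).
  by move=> c b1 b2; rewrite !linearP /=; ring.
have Dh : chi_derivation chi t s h.
  by move=> b1 b2; rewrite !hE Dg !quotient_characterM; ring.
(* This is the rule applied to the zero product of the idempotents at [t] and [s]. *)
have gst : g (pi_vertex s) + g (pi_vertex t) = 0.
  have := Dg (pi_vertex t) (pi_vertex s); rewrite pi_vertexM ?ts // linear0.
  by rewrite !quotient_character_vertex !eqxx mul1r mulr1.
apply/eqP; rewrite -subr_eq0 -hE; apply/eqP.
apply: (chi_derivation_eq0 Dh) => [z|al].
  rewrite hE !quotient_character_vertex; case/orP: (vst z) => /eqP ->.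
    by rewrite eqxx (negPf st) subr0 mulr1 subrr.
  by rewrite eqxx ts sub0r mulrN1 opprK addrC.
by rewrite hE ga !quotient_character_arrow subrr mulr0 subrr.
Qed.

End AdmissibleQuotient.

(* B = kQ/I is given by the quotient map pi. *)
Theorem corollary1p2 (k : closedFieldType) (Q : quiver)
    (I : pathalg k Q -> Prop) (hI : admissible I)
    (B : falgType k) (pi : {rmorphism pathalg k Q -> B})
    (pi_scalable : scalable pi)
    (pi_surj : forall b : B, exists a : pathalg k Q, pi a = b)
    (pi_ker : forall a : pathalg k Q, pi a = 0 <-> I a) :
  zariski_irreducible (\dim {:B}).-1 (AlgGr B (\dim {:B}).-1) <->
  [\/ exists2 m : nat, (1 <= m)%N & is_loop_quiver m Q,
      exists2 m : nat, (1 <= m)%N & is_kronecker_quiver m Q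
    | is_two_isolated_vertices Q].
Proof.
have [chi chiE] := quotient_characters hI pi_scalable pi_surj pi_ker.
have chiM := quotient_characterM pi_surj chiE.
have chi1 := quotient_character1 chiE.
have chi_nil := quotient_character_nil hI pi_surj pi_ker chiE.
split.
  case/(AlgGr_irreducible_derivation chiM chi1 chi_nil) => x [y].
  case=> [[f [b [Df fb]]] sub].
  exact: (dominating_derivations_quiver hI pi_scalable pi_surj pi_ker chiE
    Df fb sub).
have irr := derivation_AlgGr_irreducible chiM chi1 chi_nil.
have bipartite s t : s != t -> (forall z, (z == s) || (z == t)) ->
    (forall al : arrow Q, source al = s /\ target al = t) ->
    zariski_irreducible (\dim {:B}).-1 (AlgGr B (\dim {:B}).-1).
  move=> st vst ast.
  have [f [b [Df fb sub]]] :=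
    bipartite_quiver_dominating pi_scalable pi_surj chiE st vst ast.
  exact: irr Df fb sub.
case=> [[m m1 lQ]|[m m1 [s [t [st vst ast _]]]]|[v2 a0]].
- have [x [f [b [Df fb sub]]]] :=
    loop_quiver_dominating hI pi_scalable pi_surj pi_ker chiE m1 lQ.
  exact: irr Df fb sub.
- exact: bipartite st vst ast.
have /cards2P[s [t [st vE]]] : #|[set: vertex Q]| == 2%N.
  by apply/eqP; rewrite cardsT.
have vst z : (z == s) || (z == t) by rewrite -in_set2 -vE inE.
have ast (al : arrow Q) : source al = s /\ target al = t.
  by have := card0_eq a0 al; rewrite inE.
exact: bipartite st vst ast.
Qed.
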